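(* Let $G$ be a Gauss diagram. For all proper ERS loops $\gamma$ in $G$, $$\mathcal T(\gamma)=\ \nearrow(\sigma_\gamma).$$
   Context: A Gauss diagram $G$ of degree $n$ is an oriented circle with $2n$ distinct points paired by $n$ abstract oriented arrows (each from a tail to a head; signs and other decorations are irrelevant here). Its edges are the $2n$ arcs of circle between consecutive arrow ends (the whole circle if $n=0$). $G$ is regarded as a $1$-dimensional cell complex whose oriented $1$-cells are the edges and the arrows (arrows do not intersect topologically). For a $1$-cell $c$, $\langle\cdot,c\rangle:H_1(G)\to\mathbb Z$ is the coordinate along $c$. For an arrow $A$, $[A]\in H_1(G)$ is the class of the loop that goes along $A$ from tail to head and then along the circle, following its orientation, from the head of $A$ to the tail of $A$; $[K]$ is the class of the base circle. The classes $[A]$ and $[K]$ form a basis of $H_1(G)$. The torsion $\mathcal T(\gamma)\in\mathbb Z$ of $\gamma\in H_1(G)$ is defined by $$\gamma=\sum_{\langle\gamma,A\rangle>0}\langle\gamma,A\rangle[A]+\sum_{\langle\gamma,A\rangle<0}\langle\gamma,A\rangle\big([A]-[K]\big)-\mathcal T(\gamma)[K].$$ A loop or class $\gamma$ is ER (edge-respecting) if $\langle\gamma,e\rangle\ge0$ for every edge $e$; simple if it is (the class of) an injective loop, so that $|\langle\gamma,c\rangle|\le1$ for every $1$-cell $c$; ERS if it is ER and simple; proper if it runs along at least one arrow. For a permutation $\sigma$ of $\{1,\dots,m\}$, $\nearrow(\sigma)=\#\{i:\sigma(i)>i\}$. It is invariant under conjugation of $\sigma$ by the cycle $(1\,2\,\ldots\,m)$,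 hence is well defined for permutations of a set of $m$ points lying on an oriented circle (numbered $1,\dots,m$ consecutively along the orientation, starting anywhere). For a proper simple loop $\gamma$, the set of edges $e$ with $\langle\gamma,e\rangle\neq0$ is viewed as a finite subset of the oriented base circle, and $\sigma_\gamma$ is the permutation of this set sending each edge to the next edge visited by $\gamma$.
   Formalization: In σ_γ, ''edges'' are taken as edges of the Gauss diagram formed only by the arrows γ runs along (ends of arrows that γ ignores do not separate edges); with all edges of G the equality fails, each ignored arrow end on γ adding 1 to ↗(σ_γ). *)

(* Defs.v *)
(* Mathematical Components *)
From HB Require Import structures.
From mathcomp Require Import all_boot all_order all_algebra.
From mathcomp Require Import fingroup perm.
Set Implicit Arguments.
Unset Strict Implicit.
Unset Printing Implicit Defensive.
Import Order.TTheory GRing.Theory Num.Theory.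
Local Open Scope ring_scope.

(* The 2n points of the circle are numbered cyclically, following the
   orientation, so that ordS is the next point.  For n = 0 there is one dummy
   point, the 0-cell needed to make the bare circle a cell complex whose only
   1-cell is the whole circle. *)
Definition npts (n : nat) : nat := n.*2.-1.+1.
Notation point n := 'I_(npts n).

Definition arrow_end (n : nat) (tl hd : 'I_n -> point n)
    (x : 'I_n + 'I_n) : point n :=
  match x with inl A => tl A | inr A => hd A end.

Record gauss (n : nat) := Gauss {
  arrow_tail : 'I_n -> point n;
  arrow_head : 'I_n -> point n;
  ends_inj : injective (arrow_end arrow_tail arrow_head)
}.

(* The edge number i goes from the point i to the point ordS i. *)
Notation edge n := 'I_(npts n).
Notation arrow n := 'I_n.
Definition cell (n : nat) : finType := (edge n + arrow n)%type.
Definition Edge (n : nat) (e : edge n) : cell n := inl e.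
Definition Arrow (n : nat) (A : arrow n) : cell n := inr A.

Definition csrc (n : nat) (G : gauss n) (c : cell n) : point n :=
  match c with inl e => e | inr A => arrow_tail G A end.
Definition ctgt (n : nat) (G : gauss n) (c : cell n) : point n :=
  match c with inl e => ordS e | inr A => arrow_head G A end.

Definition chain (n : nat) := {ffun cell n -> int}.

Definition boundary (n : nat) (G : gauss n) (c : chain n) :
    {ffun point n -> int} :=
  [ffun v => \sum_x c x * ((ctgt G x == v)%:R - (csrc G x == v)%:R)].

Definition cycles (n : nat) (G : gauss n) : {pred chain n} :=
  [pred c | boundary G c == 0].

Lemma cycles_zmod (n : nat) (G : gauss n) : zmod_closed (cycles G).
Proof.
split=> [|a b]; rewrite !inE.
  by apply/eqP/ffunP=> v; rewrite !ffunE big1 // => x _; rewrite ffunE mul0r.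
move=> /eqP/ffunP a0 /eqP/ffunP b0; apply/eqP/ffunP=> v.
move: (a0 v) (b0 v); rewrite !ffunE => av bv.
rewrite (eq_bigr (fun x => a x * ((ctgt G x == v)%:R - (csrc G x == v)%:R)
   - b x * ((ctgt G x == v)%:R - (csrc G x == v)%:R))).
  by rewrite sumrB av bv subr0.
by move=> x _; rewrite !ffunE mulrBl.
Qed.

HB.instance Definition _ (n : nat) (G : gauss n) :=
  GRing.isZmodClosed.Build (chain n) (cycles G) (cycles_zmod G).

(* There are no 2-cells, so a homology class is a cycle. *)
Record H1 (n : nat) (G : gauss n) :=
  MkH1 { h1val : chain n; _ : h1val \in cycles G }.

HB.instance Definition _ (n : nat) (G : gauss n) :=
  [isSub of H1 G for @h1val n G].
HB.instance Definition _ (n : nat) (G : gauss n) := [Choice of H1 G by <:].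
HB.instance Definition _ (n : nat) (G : gauss n) :=
  [SubChoice_isSubZmodule of H1 G by <:].

Definition coef (n : nat) (G : gauss n) (g : H1 G) (c : cell n) : int :=
  h1val g c.

(* In a step (c, r), the flag r tells whether c is run backwards. *)
Definition step (n : nat) : Type := (cell n * bool)%type.

Definition ssrc (n : nat) (G : gauss n) (x : step n) : point n :=
  if x.2 then ctgt G x.1 else csrc G x.1.
Definition stgt (n : nat) (G : gauss n) (x : step n) : point n :=
  if x.2 then csrc G x.1 else ctgt G x.1.

Definition follows (n : nat) (G : gauss n) : rel (step n) :=
  fun x y => stgt G x == ssrc G y.

Record loop (n : nat) (G : gauss n) := Loop {
  steps : seq (step n);
  _ : (0 < size steps)%N;
  loop_closed : path.cycle (follows G) steps
}.

Definition steps_chain (n : nat) (s : seq (step n)) : chain n :=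
  [ffun c => \sum_(x <- s | x.1 == c) (-1) ^+ x.2].

Lemma steps_chain_cycle (n : nat) (G : gauss n) (s : seq (step n)) :
  path.cycle (follows G) s -> steps_chain s \in cycles G.
Proof.
move=> cs; rewrite inE; apply/eqP/ffunP=> v; rewrite !ffunE.
have st : map (stgt G) s = rot 1 (map (ssrc G) s).
  case: s cs => //= x p; rewrite rot1_cons.
  elim: p {1 3}x => [|y p IHp] z /=; first by rewrite andbT => /eqP ->.
  by case/andP=> /eqP -> /IHp ->.
transitivity
  (\sum_(x <- s) ((stgt G x == v)%:R - (ssrc G x == v)%:R) : int).
  under eq_bigr => c _ do rewrite ffunE big_mkcond mulr_suml.
  rewrite exchange_big; apply: eq_bigr => -[c r] _.
  rewrite (bigD1 c) //= eqxx big1 ?addr0.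
    by case: r; rewrite /stgt /ssrc /= ?expr1 ?expr0 ?mul1r // mulN1r opprB.
  by move=> c' /negPf; rewrite eq_sym => ->; rewrite mul0r.
have mapE (f : step n -> point n) :
    \sum_(x <- s) (f x == v)%:R = \sum_(w <- map f s) (w == v)%:R :> int.
  by rewrite big_map.
rewrite sumrB !mapE st [X in X - _](perm_big (map (ssrc G) s)) ?subrr //=.
by rewrite perm_rot.
Qed.

Definition hclass (n : nat) (G : gauss n) (g : loop G) : H1 G :=
  MkH1 (steps_chain_cycle (loop_closed g)).

Definition edge_steps (n : nat) (es : seq (edge n)) : seq (step n) :=
  [seq (Edge e, false) | e <- es].

Definition base_steps (n : nat) : seq (step n) :=
  edge_steps (traject (@ordS _) (ord0 : point n) (npts n)).

(* The edges met when going along the circle from p to q. *)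
Definition circle_arc (n : nat) (p q : point n) : seq (edge n) :=
  traject (@ordS _) p ((q + npts n - p) %% npts n)%N.

Definition arrow_steps (n : nat) (G : gauss n) (A : arrow n) : seq (step n) :=
  (Arrow A, false) :: edge_steps (circle_arc (arrow_head G A) (arrow_tail G A)).

Lemma iter_ordS (N : nat) (p : 'I_N) (k : nat) :
  iter k (@ordS _) p = ((p + k) %% N)%N :> nat.
Proof.
elim: k => [|k IHk]; first by rewrite addn0 modn_small.
by rewrite iterS /= IHk -addn1 modnDml addn1 addnS.
Qed.

Lemma path_edges (n : nat) (G : gauss n) (z y : step n) (p : point n) k :
  stgt G z = p -> ssrc G y = iter k (@ordS _) p ->
  path (follows G) z (rcons (edge_steps (traject (@ordS _) p k)) y).
Proof.
elim: k z p => [|k IHk] z p zp yp /=; first by rewrite andbT /follows zp yp.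
by rewrite {1}/follows zp eqxx /=; apply: IHk => //; rewrite yp iterSr.
Qed.

Lemma base_closed (n : nat) (G : gauss n) :
  path.cycle (follows G) (base_steps n).
Proof.
rewrite /base_steps /npts /=; apply: path_edges => //; apply: val_inj.
by rewrite -iterSr [RHS]iter_ordS add0n modnn.
Qed.

Lemma arrow_closed (n : nat) (G : gauss n) (A : arrow n) :
  path.cycle (follows G) (arrow_steps G A).
Proof.
rewrite /arrow_steps /=; apply: path_edges => //; apply: val_inj.
rewrite [RHS]iter_ordS /ssrc /= modnDmr subnKC.
  by rewrite modnDr modn_small // ltn_ord.
by rewrite (leq_trans (ltnW (ltn_ord (arrow_head G A)))) // leq_addl.
Qed.

Definition base_loop (n : nat) (G : gauss n) : loop G :=
  @Loop n G (base_steps n) isT (base_closed G).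
Definition arrow_loop (n : nat) (G : gauss n) (A : arrow n) : loop G :=
  @Loop n G (arrow_steps G A) isT (arrow_closed G A).

Definition Kcl (n : nat) (G : gauss n) : H1 G := hclass (base_loop G).
Definition Acl (n : nat) (G : gauss n) (A : arrow n) : H1 G :=
  hclass (arrow_loop G A).

Definition torsion_eq (n : nat) (G : gauss n) (g : H1 G) (t : int) : bool :=
  g == \sum_(A | 0 < coef g (Arrow A)) Acl G A *~ coef g (Arrow A)
     + \sum_(A | coef g (Arrow A) < 0) (Acl G A - Kcl G) *~ coef g (Arrow A)
     - Kcl G *~ t.

Section TorsionExists.
Variables (n : nat) (G : gauss n).

Lemma coefB (a b : H1 G) c : coef (a - b) c = coef a c - coef b c.
Proof. by rewrite /coef -[h1val (a - b)]/(val (a - b)) raddfB /= !ffunE. Qed.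

Lemma coefD (a b : H1 G) c : coef (a + b) c = coef a c + coef b c.
Proof. by rewrite /coef -[h1val (a + b)]/(val (a + b)) raddfD /= !ffunE. Qed.

Lemma coef0 c : coef (0 : H1 G) c = 0.
Proof. by rewrite /coef -[h1val 0]/(val (0 : H1 G)) raddf0 ffunE. Qed.

Lemma coefMz (a : H1 G) c z : coef (a *~ z) c = coef a c *~ z.
Proof.
have nat_case m : coef (a *+ m) c = coef a c *+ m.
  by elim: m => [|m IHm]; rewrite ?mulr0n ?coef0 // !mulrS coefD IHm.
case: z => m; first exact: nat_case.
by rewrite NegzE !mulrNz -[- (_ *~ _)]sub0r coefB coef0 sub0r nat_case.
Qed.

Lemma coef_sum (I : finType) (P : pred I) (F : I -> H1 G) c :
  coef (\sum_(i | P i) F i) c = \sum_(i | P i) coef (F i) c.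
Proof. by elim/big_rec2: _ => [|i x y _ <-]; rewrite ?coef0 ?coefD. Qed.

Lemma coef_inj (a b : H1 G) : coef a =1 coef b -> a = b.
Proof. by move=> ab; apply: val_inj; apply/ffunP. Qed.

Lemma edge_steps_arrow (es : seq (edge n)) A :
  steps_chain (edge_steps es) (Arrow A) = 0.
Proof. by rewrite ffunE big_map big1. Qed.

Lemma coefK_arrow A : coef (Kcl G) (Arrow A) = 0.
Proof. exact: edge_steps_arrow. Qed.

Lemma coefA_arrow A B : coef (Acl G A) (Arrow B) = (A == B)%:R.
Proof.
rewrite /coef /= ffunE big_cons -[X in if _ then _ + X else X]add0r.
have := edge_steps_arrow (circle_arc (arrow_head G A) (arrow_tail G A)) B.
rewrite ffunE => ->; rewrite /Arrow /= addr0.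
by rewrite -[inr A == inr B]/(A == B); case: eqP.
Qed.

Lemma coefK_edge e : coef (Kcl G) (Edge e) = 1.
Proof.
rewrite /coef /= ffunE big_map.
have U : uniq (traject (@ordS _) (ord0 : point n) (npts n)).
  rewrite -(map_inj_uniq val_inj).
  have -> : [seq val i | i <- traject (@ordS _) (ord0 : point n) (npts n)]
            = iota 0 (npts n); last exact: iota_uniq.
  apply: (@eq_from_nth _ 0%N); first by rewrite size_map size_traject size_iota.
  move=> i; rewrite size_map size_traject => lti.
  rewrite (nth_map ord0) ?size_traject // nth_traject // nth_iota //.
  rewrite [LHS]iter_ordS.
  by rewrite add0n modn_small.
have mem_e : e \in traject (@ordS _) (ord0 : point n) (npts n).
  apply/trajectP; exists (val e); first exact: ltn_ord.
  by apply: val_inj; rewrite [RHS]iter_ordS add0n modn_small // ltn_ord.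
rewrite (eq_bigl (fun i => i == e)) // -big_filter filter_pred1_uniq //.
by rewrite big_seq1.
Qed.

Lemma coef_edge_const (d : H1 G) :
  (forall A, coef d (Arrow A) = 0) ->
  forall e, coef d (Edge e) = coef d (Edge ord0).
Proof.
move=> dA; have step e : coef d (Edge (ordS e)) = coef d (Edge e).
  have: h1val d \in cycles G by case: (d).
  rewrite inE => /eqP/ffunP.
  move/(_ (ordS e)); rewrite !ffunE big_sumType /=.
  rewrite [X in _ + X]big1 ?addr0 => [|A _].
    rewrite (eq_bigr (fun i => h1val d (inl i) * (ordS i == ordS e)%:R
              - h1val d (inl i) * (i == ordS e)%:R));
      last by move=> i; rewrite mulrBr.
    rewrite sumrB.
    rewrite (bigD1 e) //= eqxx mulr1 big1 ?addr0; last first.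
      by move=> i /negPf ie; rewrite (inj_eq (@ordS_inj _)) ie mulr0.
    rewrite (bigD1 (ordS e)) //= eqxx mulr1 big1 ?addr0; last first.
      by move=> i /negPf ->; rewrite mulr0.
    by move/eqP; rewrite subr_eq0 => /eqP.
  by have := dA A; rewrite /coef /Arrow /= => ->; rewrite mul0r.
move=> e; have -> : e = iter (val e) (@ordS _) ord0.
  by apply: val_inj; rewrite [RHS]iter_ordS add0n modn_small // ltn_ord.
by elim: (val e) => // k IHk; rewrite iterS step.
Qed.

Lemma torsion_ex (g : H1 G) : exists t : int, torsion_eq g t.
Proof.
set R : H1 G := \sum_(A | 0 < coef g (Arrow A)) Acl G A *~ coef g (Arrow A)
  + \sum_(A | coef g (Arrow A) < 0) (Acl G A - Kcl G) *~ coef g (Arrow A).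
have RA A : coef (R - g) (Arrow A) = 0.
  have posE B : coef (Acl G B *~ coef g (Arrow B)) (Arrow A)
      = (B == A)%:R * coef g (Arrow B).
    by rewrite coefMz coefA_arrow -mulrzl mulrC intz.
  have negE B : coef ((Acl G B - Kcl G) *~ coef g (Arrow B)) (Arrow A)
      = (B == A)%:R * coef g (Arrow B).
    by rewrite coefMz coefB coefA_arrow coefK_arrow subr0 -mulrzl mulrC intz.
  rewrite coefB coefD !coef_sum (eq_bigr _ (fun B _ => posE B)).
  rewrite [X in _ + X - _](eq_bigr _ (fun B _ => negE B)).
  rewrite big_mkcond [X in _ + X - _]big_mkcond -big_split /=.
  rewrite (bigD1 A) //= eqxx !mul1r big1 ?addr0.
    by case: ltrgt0P => h; rewrite ?addr0 ?add0r ?subrr ?subr0 // ?h.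
  by move=> B /negPf ->; rewrite !mul0r !if_same addr0.
pose t := coef (R - g) (Edge ord0); exists t; rewrite /torsion_eq -/R.
rewrite eq_sym subr_eq addrC -subr_eq; apply/eqP/coef_inj => c.
rewrite coefMz.
case: c => [e|A]; last by rewrite -/(Arrow A) RA coefK_arrow mul0rz.
by rewrite -/(Edge e) /t (coef_edge_const RA) coefK_edge intz.
Qed.

End TorsionExists.

Definition torsion (n : nat) (G : gauss n) (g : H1 G) : int :=
  xchoose (torsion_ex g).

Lemma torsionP (n : nat) (G : gauss n) (g : H1 G) (t : int) :
  torsion_eq g t <-> torsion g = t.
Proof.
split=> [gt|<-]; last exact: xchooseP.
have gT : torsion_eq g (torsion g) by exact: xchooseP.
move: gt; rewrite /torsion_eq {1}(eqP gT) => /eqP /addrI /oppr_inj.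
move/(congr1 (fun d => coef d (Edge ord0))).
by rewrite !coefMz coefK_edge !intz.
Qed.

Definition edge_respecting (n : nat) (G : gauss n) (g : H1 G) : bool :=
  [forall e, 0 <= coef g (Edge e)].

(* The loop is injective: it visits pairwise distinct points through pairwise
   distinct 1-cells.  The second condition only matters for loops of two
   steps, where it excludes going back and forth along a 1-cell. *)
Definition simple_loop (n : nat) (G : gauss n) (g : loop G) : bool :=
  uniq [seq ssrc G x | x <- steps g] && uniq [seq x.1 | x <- steps g].

Definition is_arrow (n : nat) (c : cell n) : bool :=
  if c is inr _ then true else false.

Definition proper_loop (n : nat) (G : gauss n) (g : loop G) : bool :=
  has (fun x => is_arrow x.1) (steps g).

Definition nearrow (m : nat) (s : 'S_m) : nat :=
  #|[set i : 'I_m | (i < s i)%N]|.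

Definition cyc_perm (m : nat) : 'S_m := perm (@ordS_inj m).

Lemma nearrowJ (m : nat) (s : 'S_m) :
  nearrow (s ^ cyc_perm m)%g = nearrow s.
Proof.
case: m s => [|m] s; first by apply: eq_card => -[].
have step i : (s ^ cyc_perm m.+1)%g (ordS i) = ordS (s i).
  have -> : ordS i = cyc_perm m.+1 i by rewrite permE.
  by rewrite permJ permE.
rewrite /nearrow -!sum1_card.
rewrite (reindex_inj (@ordS_inj m.+1)) /=.
under eq_bigl => i do rewrite inE step.
under [RHS]eq_bigl => i do rewrite inE.
have S_lt (i : 'I_m.+1) : i != ord_max -> (i.+1 %% m.+1)%N = i.+1.
  by rewrite -val_eqE /= => h; rewrite modn_small // ltn_neqAle eqSS h ltn_ord.
rewrite big_mkcond [RHS]big_mkcond /=.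
have [smax|smax] := eqVneq (s ord_max) ord_max.
  apply: eq_bigr => i _; have [->|im] := eqVneq i ord_max.
    by rewrite smax !ltnn.
  rewrite !S_lt // -?[X in _ != X]smax ?(inj_eq perm_inj) //.
pose j := (s^-1)%g ord_max; have sj : s j = ord_max by rewrite permKV.
have jmax : j != ord_max.
  by apply: contraNneq smax => jm; rewrite -{1}jm sj.
rewrite (bigD1 (@ord_max m)) //= (bigD1 j) //=.
rewrite [RHS](bigD1 (@ord_max m)) //= [X in _ = (_ + X)%N](bigD1 j) //=.
rewrite sj /= modnn !ltn0 (S_lt _ smax) /= add0n.
have -> : (m < s ord_max)%N = false by rewrite ltnNge -ltnS ltn_ord.
have -> : (j < m)%N.
  by rewrite ltn_neqAle -ltnS ltn_ord andbT; rewrite -val_eqE in jmax.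
rewrite add0n; congr (_ + _)%N; apply: eq_bigr => i /andP[im ij].
by rewrite !S_lt // -sj (inj_eq perm_inj).
Qed.

Lemma renumber_inj (T : finType) (s : {perm T}) :
  injective (fun i : 'I_#|T| => enum_rank (s (enum_val i))).
Proof. by move=> i j /enum_rank_inj /perm_inj /enum_val_inj. Qed.

Definition renumber (T : finType) (s : {perm T}) : 'S_#|T| :=
  perm (@renumber_inj T s).

Lemma enum_rank_edge (n : nat) (S : {set edge n}) (x y : {e | e \in S}) :
  (enum_rank x < enum_rank y)%N = (val x < val y)%N.
Proof.
have srt : sorted (fun u v : {e | e \in S} => (val u < val v)%N)
    (enum {: {e | e \in S}}).
  have E : [seq val u | u <- enum {: {e | e \in S}}] = enum (mem S).
    rewrite enumT [Finite.enum]unlock /=.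
    apply: etrans (pmap_filter (@insubK _ _ {e | e \in S}) _) _.
    by apply: eq_filter => u; rewrite isSome_insub.
  have : sorted ltn [seq val v | v <- enum (mem S)].
    rewrite sorted_map {1}/enum_mem -enumT; apply: sorted_filter.
      by move=> u v w; apply: ltn_trans.
    by rewrite -sorted_map val_enum_ord iota_ltn_sorted.
  by rewrite -E !sorted_map.
have homo (u v : {e | e \in S}) :
    (enum_rank u < enum_rank v)%N -> (val u < val v)%N.
  move=> uv.
  have tr : transitive (fun u v : {e | e \in S} => (val u < val v)%N).
    by move=> ? ? ?; apply: ltn_trans.
  have := sorted_ltn_nth tr x srt; move/(_ (enum_rank u) (enum_rank v)).
  by rewrite !inE -cardE !ltn_ord !nth_enum_rank => ->.
apply/idP/idP => [/homo //|xy]; rewrite ltnNge; apply/negP.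
rewrite leq_eqVlt => /orP[/eqP/val_inj/enum_rank_inj xy'|/homo].
  by rewrite xy' ltnn in xy.
by rewrite ltnNge ltnW.
Qed.

(* By enum_rank_edge, enum_rank numbers S consecutively along the orientation
   of the circle, starting from the point 0.  The choice of the starting point
   is irrelevant by nearrowJ. *)
Definition nearrow_circle (n : nat) (S : {set edge n})
    (s : {perm {e | e \in S}}) : nat :=
  nearrow (renumber s).

Definition edge_of_cell (n : nat) (c : cell n) : option (edge n) :=
  if c is inl e then Some e else None.

Definition visited_edges (n : nat) (G : gauss n) (g : loop G) : seq (edge n) :=
  pmap (fun x => edge_of_cell x.1) (steps g).

Definition on_visited_arrow (n : nat) (G : gauss n) (g : H1 G) (p : point n) :
    bool :=
  [exists A, (coef g (Arrow A) != 0) &&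
             ((p == arrow_tail G A) || (p == arrow_head G A))].

(* The ends of an arrow that g ignores do not separate edges here: for a proper
   simple loop g, the edges are those of the Gauss diagram formed by the arrows
   along which g runs.  Each of them is a maximal run of consecutive edges of G
   with no visited arrow end inside, and is represented by the last edge of the
   run.  Were ignored arrow ends to count, splitting an edge of g by the end of
   one of them would add 1 to nearrow and leave the torsion unchanged. *)
Definition loop_edges (n : nat) (G : gauss n) (g : H1 G) : {set edge n} :=
  [set e | (coef g (Edge e) != 0) && on_visited_arrow g (ordS e)].

Lemma loop_edges_all (n : nat) (G : gauss n) (g : H1 G) :
  (0 < n)%N -> (forall A, coef g (Arrow A) != 0) ->
  loop_edges g = [set e | coef g (Edge e) != 0].
Proof.
move=> n_gt0 gA; apply/setP=> e; rewrite !inE.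
suff -> : on_visited_arrow g (ordS e) by rewrite andbT.
have /(inj_card_bij (@ends_inj n G)) [f _ fK] :
    (#|{: point n}| <= #|{: 'I_n + 'I_n}|)%N.
  by rewrite card_sum !card_ord addnn /npts prednK // double_gt0.
apply/existsP; case: (f (ordS e)) (fK (ordS e)) => A /= <-; exists A;
  by rewrite gA eqxx ?orbT.
Qed.

Definition loop_edge_seq (n : nat) (G : gauss n) (g : loop G) : seq (edge n) :=
  [seq e <- visited_edges g | e \in loop_edges (hclass g)].

Lemma loop_edge_seq_uniq (n : nat) (G : gauss n) (g : loop G) :
  simple_loop g -> uniq (loop_edge_seq g).
Proof.
case/andP=> _ U; apply: filter_uniq.
rewrite -(map_inj_uniq (@inl_inj _ (arrow n))).
apply: subseq_uniq U; rewrite /visited_edges.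
elim: (steps g) => //= -[[e|A] r] s IHs /=; first by rewrite eqxx.
exact: (subseq_trans IHs (subseq_cons _ _)).
Qed.

Lemma mem_loop_edge_seq (n : nat) (G : gauss n) (g : loop G) :
  loop_edge_seq g =i loop_edges (hclass g).
Proof.
move=> e; rewrite mem_filter andb_idr // inE => /andP[ce _].
apply: contraR ce => /negP ne; apply/eqP.
rewrite /coef /= ffunE big_seq_cond big1 //.
move=> [c r] /andP[xs /eqP /= ec]; case: ne.
rewrite /visited_edges mem_pmap; apply/mapP; exists (c, r) => //=.
by rewrite ec.
Qed.

Lemma sigma_mem (n : nat) (G : gauss n) (g : loop G)
    (e : {e | e \in loop_edges (hclass g)}) :
  next (loop_edge_seq g) (val e) \in loop_edges (hclass g).
Proof. by rewrite -mem_loop_edge_seq mem_next mem_loop_edge_seq (valP e). Qed.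

Definition sigma_fun (n : nat) (G : gauss n) (g : loop G)
    (e : {e | e \in loop_edges (hclass g)}) :
    {e | e \in loop_edges (hclass g)} :=
  Sub (next (loop_edge_seq g) (val e)) (sigma_mem e).

Lemma sigma_inj (n : nat) (G : gauss n) (g : loop G) :
  simple_loop g -> injective (@sigma_fun n G g).
Proof.
move=> /loop_edge_seq_uniq U x y /(congr1 val) /= xy.
exact/val_inj/(can_inj (prev_next U) xy).
Qed.

Definition sigma (n : nat) (G : gauss n) (g : loop G) (gs : simple_loop g) :
    {perm {e | e \in loop_edges (hclass g)}} :=
  perm (sigma_inj gs).

(* Main.v *)
(* Both sides are compared with the number J of jumps p -> q with p < q (the
   loop runs along an arrow from the point p to the point q).
   Torsion: the loop of an arrow covers the last edge, which ends at the
   point 0, iff its tail precedes its head; hence the coefficient of the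
   torsion formula along that edge reads T = J - <g, last edge>.
   Ascents: follow the loop, remembering the last visited edge c that precedes
   a jump; how the comparison of c with the current point varies from one step
   to the next gives, after one turn, J - <g, last edge> as well. *)
Require Import Defs.
From mathcomp Require Import all_boot all_order all_algebra.
From mathcomp Require Import fingroup perm.
From mathcomp Require Import zify.
Set Implicit Arguments.
Unset Strict Implicit.
Unset Printing Implicit Defensive.
Import Order.TTheory GRing.Theory Num.Theory.
Local Open Scope ring_scope.

(** * Ascents of cyclic words *)

Fixpoint ascents (m : nat) (c : 'I_m) (l : seq 'I_m) : nat :=
  if l is y :: l' then ((c < y) + ascents y l')%N else 0%N.

Lemma map_next (T : eqType) (l : seq T) : uniq l -> map (next l) l = rot 1 l.
Proof.
case: l => [|x p] // U; have U1 := U; rewrite rot1_cons.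
apply: (@eq_from_nth _ x); rewrite size_map ?size_rcons // => i lti.
rewrite (nth_map x) // next_nth mem_nth // index_uniq // nth_rcons.
case: ltngtP => // h; last by rewrite nth_default // h.
by move: lti => /=; rewrite ltnS leqNgt h.
Qed.

Lemma uniq_map_inj (S T : eqType) (f : S -> T) (s : seq S) :
  uniq (map f s) -> {in s &, injective f}.
Proof.
elim: s => //= a s IHs /andP[as_ /IHs inj] x y.
rewrite !inE => /predU1P[->|xs] /predU1P[->|ys] // fxy; last exact: inj.
  by case/negP: as_; rewrite fxy map_f.
by case/negP: as_; rewrite -fxy map_f.
Qed.

Lemma sum_zip_ascents (m : nat) (x z : 'I_m) (p : seq 'I_m) :
  (\sum_(u <- zip (x :: p) (rcons p z)) (u.1 < u.2) =
   ascents x (rcons p z))%N.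
Proof.
by elim: p x => [|y p IHp] x /=; rewrite big_cons /= ?big_nil // IHp.
Qed.

Lemma ascents_rcons (m : nat) (x z : 'I_m) (p : seq 'I_m) :
  ascents x (rcons p z) = (ascents x p + (last x p < z))%N.
Proof.
by elim: p x => [|y p IHp] x /=; rewrite ?addn0 ?add0n // IHp addnA.
Qed.

(** Starting from the last letter closes the word into a cycle; [c] is only a default for the empty
    word. *)
Lemma sum_next_ascents (m : nat) (c : 'I_m) (l : seq 'I_m) :
  uniq l -> (\sum_(e <- l) (e < next l e) = ascents (last c l) l)%N.
Proof.
move=> U; transitivity (\sum_(u <- zip l (map (next l) l)) (u.1 < u.2))%N.
  by rewrite -[X in zip X _]map_id zip_map big_map.
rewrite map_next //; case: l U => [|x p] U; first by rewrite big_nil.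
by rewrite rot1_cons sum_zip_ascents ascents_rcons addnC.
Qed.

(** The renumbering is increasing by [enum_rank_edge], so ascents can be counted on the edges
    themselves. *)
Lemma nearrow_circleE (n : nat) (S : {set edge n})
    (s : {perm {e | e \in S}}) :
  nearrow_circle s = (\sum_(x : {e | e \in S}) (val x < val (s x)))%N.
Proof.
rewrite /nearrow_circle /nearrow -sum1_card.
rewrite (reindex (@enum_rank {e | e \in S})) /=; last first.
  by apply: onW_bij; apply: enum_rank_bij.
rewrite big_mkcond; apply: eq_bigr => x _.
by rewrite inE permE enum_rankK enum_rank_edge; case: ltnP.
Qed.

Lemma nearrow_sigma (n : nat) (G : gauss n) (g : loop G)
    (gs : simple_loop g) (c : edge n) :
  nearrow_circle (sigma gs) =
  ascents (last c (loop_edge_seq g)) (loop_edge_seq g).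
Proof.
have U := loop_edge_seq_uniq gs.
rewrite nearrow_circleE -sum_next_ascents //.
under [LHS]eq_bigr => x _ do rewrite permE /=.
rewrite (perm_big (enum (loop_edges (hclass g)))) /=; last first.
  apply: uniq_perm; rewrite ?enum_uniq // => e.
  by rewrite mem_loop_edge_seq mem_enum.
by rewrite big_enum /= [RHS]big_sub.
Qed.

(** * Following a loop step by step *)

Lemma ltn_ordS_neq (m : nat) (c v : 'I_m.+1) :
  c != v -> ((c < ordS v) + (v == ord_max) = (c < v))%N.
Proof.
rewrite -!val_eqE /=; have [vm|vm] := eqVneq (v : nat) m.
  by rewrite vm modnn ltn0 => cm; have := ltn_ord c; lia.
by have := ltn_ord v => ltv; rewrite modn_small; lia.
Qed.

Lemma ltn_ordS (m : nat) (v : 'I_m.+1) :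
  ((v < ordS v) + (v == ord_max) = 1)%N.
Proof.
rewrite -!val_eqE /=; have [->|vm] := eqVneq (v : nat) m.
  by rewrite modnn ltn0.
by have := ltn_ord v => ltv; rewrite modn_small; lia.
Qed.

(** Moves the start of a jump back from [ordS v] to the edge [v] preceding it. *)
Lemma ordS_ltn (m : nat) (v q : 'I_m.+1) :
  ordS v != q -> ((ordS v < q) = (v < q) + (v == ord_max) :> nat)%N.
Proof.
rewrite -!val_eqE /=; have [->|vm] := eqVneq (v : nat) m.
  by rewrite modnn; have := ltn_ord q; lia.
by have := ltn_ord v => ltv; rewrite modn_small; lia.
Qed.

Section Potential.
Variables (n : nat) (G : gauss n) (L : {set edge n}).

(* L stands for the set of the edges that are followed by an arrow. *)
Definition marked (x : step n) : bool :=
  if x.1 is inl e then e \in L else false.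

Definition marked_edges (s : seq (step n)) : seq (edge n) :=
  [seq e <- pmap (fun x => edge_of_cell x.1) s | e \in L].

Definition turns : rel (step n) :=
  fun x y => follows G x y && (marked x == is_arrow y.1).

Definition weight (x : step n) : int :=
  if x.1 is inl e then - (e == ord_max)%:Z
  else (ssrc G x < stgt G x)%N%:Z.

(* The second term cancels the step that the first one makes when c becomes
   the marked edge x itself. *)
Definition potential (c : edge n) (x : step n) : int :=
  (c < stgt G x)%N%:Z - (marked x)%:Z.

Lemma arrow_step_neq (A : arrow n) (r : bool) :
  ssrc G (Arrow A, r) != stgt G (Arrow A, r).
Proof.
have neq : arrow_tail G A != arrow_head G A.
  by apply/eqP => h; have := @ends_inj n G (inl A) (inr A) h.
by rewrite /ssrc /stgt /=; case: r; rewrite // eq_sym.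
Qed.

(** By induction, with [c] the last marked edge so far: each weight is the change of potential, plus
    the ascent from [c] when the step is marked. *)
Lemma sum_weight_path (c : edge n) (x : step n) (s : seq (step n)) :
  c \in L -> (marked x -> x.1 = Edge c) -> path turns x s ->
  all (fun y => ~~ y.2 || is_arrow y.1) (x :: s) ->
  \sum_(y <- s) weight y = (ascents c (marked_edges s))%:Z
    + potential (last c (marked_edges s)) (last x s) - potential c x.
Proof.
elim: s c x => [|y s IHs] c x cL xc; first by rewrite big_nil /= add0r subrr.
move=> /andP[/andP[/eqP xy /eqP mxy] pth] /andP[fx fs].
rewrite big_cons; have fy := fs; move: fy => /= /andP[fy _].
case: y mxy xy pth fs fy => -[v|A] r /= mxy xy pth fs fy.
  change (edge n) in v.
  move: fy fs pth xy; rewrite orbF => /negbTE -> fs pth xy.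
  have -> : marked_edges ((inl v, false) :: s) =
      if v \in L then v :: marked_edges s else marked_edges s by [].
  have wv : weight (inl v, false) = - (v == ord_max)%:Z by [].
  have px : potential c x = (c < v)%N%:Z by rewrite /potential mxy xy subr0.
  have [vL|vL] := boolP (v \in L).
    (* The ascent from [c] to [v] absorbs the old potential; the new one is -1 if [v] is the last
       edge and 0 otherwise. *)
    have pv : potential v (inl v, false) = (v < ordS v)%N%:Z - 1.
      by rewrite /potential /marked /= vL.
    rewrite (IHs v _ vL _ pth fs) // wv px pv [ascents _ (_ :: _)]/=.
    rewrite [last c _]/=.
    by have := ltn_ordS v; move: (v < ordS v)%N (v == ord_max) => ? ?; lia.
  have cv : c != v by apply: contraNneq vL => <-.
  have pv : potential c (inl v, false) = (c < ordS v)%N%:Z.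
    by rewrite /potential /marked /= (negPf vL) subr0.
  rewrite (IHs c _ cL _ pth fs); last by rewrite /marked /= (negPf vL).
  rewrite wv px pv.
  have := ltn_ordS_neq cv.
  by move: (c < v)%N (c < ordS v)%N (v == ord_max) => ? ? ?; lia.
have -> : marked_edges ((inr A, r) :: s) = marked_edges s by [].
rewrite (IHs c _ cL _ pth fs) //.
(* An arrow follows a marked step, which is [c] run forwards: the jump starts at [ordS c]. *)
have xE := xc mxy; move: fx; rewrite xE /= orbF => /negPf xf.
have xt : stgt G x = ordS c by rewrite /stgt xE xf.
have := arrow_step_neq A r; rewrite /Arrow -xy xt => /ordS_ltn.
have -> : weight (inr A, r) = (ordS c < stgt G (inr A, r))%N%:Z.
  by rewrite -xt xy.
have -> : potential c x = (c < ordS c)%N%:Z - 1.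
  by rewrite /potential mxy xt.
have -> : potential c (inr A, r) = (c < stgt G (inr A, r))%N%:Z.
  by rewrite /potential /marked subr0.
by have := ltn_ordS c;
  move: (c < ordS c)%N (ordS c < _)%N (c < stgt _ _)%N (c == _) => ? ? ? ?; lia.
Qed.
End Potential.

(** * Torsion as a sum of weights *)

Lemma sum_traject_ord_max (m : nat) (p : 'I_m.+1) (k : nat) :
  (k <= m.+1)%N ->
  (\sum_(e <- traject (@ordS _) p k) (e == ord_max) = (m < p + k) :> nat)%N.
Proof.
elim: k p => [|k IHk] p lek /=.
  by rewrite big_nil; have := ltn_ord p; lia.
rewrite big_cons IHk ?(ltnW lek) // -val_eqE /=.
have [->|pm] := eqVneq (p : nat) m; first by rewrite modnn; lia.
by have := ltn_ord p => ltp; rewrite modn_small; lia.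
Qed.

(** For tail [p], head [q] and [m] points, the left side says that the arc from [q] to [p] covers
    the last edge. *)
Lemma arc_wraps (m p q : nat) :
  (p < m)%N -> (q < m)%N -> ((m <= q + (p + m - q) %% m) = (p < q))%N.
Proof.
move=> ltp ltq; have [lepq|ltpq] := leqP q p.
  have -> : (p + m - q = (p - q) + m)%N by lia.
  by rewrite modnDr modn_small; lia.
by rewrite modn_small; lia.
Qed.

Lemma coefA_max (n : nat) (G : gauss n) (A : arrow n) :
  coef (Acl G A) (Edge ord_max) = (arrow_tail G A < arrow_head G A)%N%:Z.
Proof.
rewrite /coef /= ffunE big_cons /= big_map /=.
rewrite (eq_bigl (fun e : edge n => e == ord_max)) //.
rewrite big_mkcond /=.
transitivity ((\sum_(e <- circle_arc (arrow_head G A) (arrow_tail G A))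
   (e == ord_max))%N%:Z).
  rewrite (big_morph Posz PoszD (erefl _)); apply: eq_bigr => e _.
  by rewrite expr0; case: (e == _).
rewrite sum_traject_ord_max; last by rewrite ltnW // ltn_pmod.
by congr (nat_of_bool _)%:Z; apply: arc_wraps.
Qed.

(** This is the defining formula read along the last edge, where [K] has coefficient 1 and
    [coefA_max] gives that of [A]. *)
Lemma torsionE (n : nat) (G : gauss n) (g : H1 G) :
  torsion g =
  \sum_A coef g (Arrow A) *
     ((arrow_tail G A < arrow_head G A)%N%:Z - (coef g (Arrow A) < 0)%R%:Z)
  - coef g (Edge ord_max).
Proof.
have /eqP gE := xchooseP (torsion_ex g); rewrite -/(torsion g) in gE.
have := congr1 ((@coef n G)^~ (Edge ord_max)) gE; cbv beta.
rewrite Defs.coefB Defs.coefD !Defs.coef_sum Defs.coefMz coefK_edge intz => ->.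
rewrite opprB addrCA -[LHS]addr0; congr (_ + _); apply/eqP.
rewrite eq_sym subr_eq0; apply/eqP.
rewrite [X in _ = X + _]big_mkcond [X in _ = _ + X]big_mkcond -big_split.
apply: eq_bigr => A _.
rewrite !Defs.coefMz Defs.coefB coefA_max coefK_edge !mulrzz /=.
by case: ltrgt0P => [||->]; rewrite ?subr0 ?addr0 ?add0r ?mul0r // mulrC.
Qed.

(** At most one step runs along [c]. Quantifying [F] inside lets one flag [r] serve both weights and
    coefficients. *)
Lemma sum_step_cell (n : nat) (s : seq (step n)) (c : cell n) :
  uniq [seq x.1 | x <- s] ->
  (forall F : step n -> int, \sum_(x <- s | x.1 == c) F x = 0) \/
  exists r, forall F : step n -> int, \sum_(x <- s | x.1 == c) F x = F (c, r).
Proof.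
elim: s => [|[d r] s IHs] /=; first by left=> F; rewrite big_nil.
case/andP=> ds /IHs {}IHs; have [dc|dc] := eqVneq d c.
  right; exists r => F; rewrite big_cons dc eqxx big_seq_cond big1 ?addr0 //.
  by move=> x /andP[xs /eqP xc]; case/negP: ds; rewrite dc -xc map_f.
case: IHs => [F0|[r' Fr]]; [left=> F | right; exists r' => F].
  by rewrite big_cons (negPf dc).
by rewrite big_cons (negPf dc).
Qed.

Lemma coef_hclass (n : nat) (G : gauss n) (g : loop G) (c : cell n) :
  coef (hclass g) c = \sum_(x <- steps g | x.1 == c) (-1) ^+ x.2.
Proof. by rewrite /coef /= ffunE. Qed.

Lemma coef_step (n : nat) (G : gauss n) (g : loop G) (x : step n) :
  uniq [seq x.1 | x <- steps g] -> x \in steps g ->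
  coef (hclass g) x.1 = (-1) ^+ x.2.
Proof.
move=> U xs; rewrite coef_hclass big_mkcond (bigD1_seq x) ?(map_uniq U) //=.
rewrite eqxx big_seq_cond big1 ?addr0 // => y /andP[ys yx].
case: eqP => // /(uniq_map_inj U) => /(_ ys xs) yxE.
by rewrite yxE eqxx in yx.
Qed.

Lemma mem_coef_neq0 (n : nat) (G : gauss n) (g : loop G) (c : cell n) :
  coef (hclass g) c != 0 -> exists r, (c, r) \in steps g.
Proof.
rewrite coef_hclass => c0.
have /hasP[[d r] xs /eqP /= dc] : has (fun x => x.1 == c) (steps g).
  by apply: contraNT c0 => h; rewrite big_hasC.
by exists r; rewrite -dc.
Qed.

Lemma sum_weight_torsion (n : nat) (G : gauss n) (g : loop G) :
  uniq [seq x.1 | x <- steps g] -> edge_respecting (hclass g) ->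
  \sum_(x <- steps g) weight G x = torsion (hclass g).
Proof.
move=> U /forallP ER; rewrite torsionE.
have -> : \sum_(x <- steps g) weight G x =
    \sum_c \sum_(x <- steps g | x.1 == c) weight G x.
  under [RHS]eq_bigr => c _ do rewrite big_mkcond.
  rewrite exchange_big; apply: eq_bigr => x _.
  rewrite (bigD1 x.1) //= eqxx big1 ?addr0 // => c.
  by rewrite eq_sym => /negPf ->.
have arrowsE :
    \sum_A \sum_(x <- steps g | x.1 == Arrow A) weight G x =
    \sum_A coef (hclass g) (Arrow A) *
      ((arrow_tail G A < arrow_head G A)%N%:Z
       - (coef (hclass g) (Arrow A) < 0)%R%:Z).
  apply: eq_bigr => A _; rewrite coef_hclass.
  have [F0|[r Fr]] := sum_step_cell (Arrow A) U; first by rewrite !F0 mul0r.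
  rewrite !Fr /weight /=.
  (* Run backwards, the arrow jumps from head to tail; as its ends differ, this comparison is the
     opposite one. *)
  have := arrow_step_neq G A r.
  rewrite /ssrc /stgt -val_eqE.
  by case: r {Fr} => /=; rewrite ?expr0 ?expr1; lia.
rewrite big_sumType [X in _ + X = _]arrowsE addrC; apply: f_equal.
rewrite (bigD1 ord_max) //= [X in _ + X]big1 ?addr0; last first.
  move=> e /negPf em; rewrite big1 // => -[c r] /eqP /= ->.
  by rewrite /weight /= em oppr0.
move: (ER ord_max); rewrite coef_hclass.
have [F0|[r Fr]] := sum_step_cell (Edge (ord_max : edge n)) U.
  by rewrite !F0 oppr0.
by rewrite !Fr /weight /= eqxx; case: (r); rewrite ?expr1 ?expr0.
Qed.

(** Each point is visited once, so a visited arrow touching the end of a visited edge must be the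
    next step. *)
Lemma cycle_turns (n : nat) (G : gauss n) (g : loop G) :
  edge_respecting (hclass g) -> simple_loop g ->
  path.cycle (turns G (loop_edges (hclass g))) (steps g).
Proof.
move=> /forallP ER /andP[Us Uc]; have U := map_uniq Us.
have fwd e r : (Edge e, r) \in steps g -> r = false.
  by move=> /(coef_step Uc) /= eE; have := ER e; rewrite eE; case: r {eE}.
have src_inj : {in steps g &, injective (ssrc G)}.
  by move=> x y; apply: (uniq_map_inj Us).
have cell_inj : {in steps g &, injective fst}.
  by move=> x y; apply: (uniq_map_inj Uc).
have nextP x : x \in steps g -> stgt G x = ssrc G (next (steps g) x).
  by move=> xs; apply/eqP; apply: (next_cycle (loop_closed g) xs).
apply: cycle_from_next => // x xs; have := nextP x xs.
have : next (steps g) x \in steps g by rewrite mem_next.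
move yE: (next _ x) => y ys xy; rewrite /turns /follows xy eqxx /=.
apply/eqP; apply/idP/idP.
  case: x xs yE xy => -[e|//] r; rewrite -/(Edge e) => xs yE xy.
  have rF := fwd _ _ xs; rewrite /marked /= inE => /andP[_ /existsP[A]].
  case/andP=> /mem_coef_neq0[r' zs] zA.
  have xt : stgt G (Edge e, r) = ordS e by rewrite rF.
  have [zy|zy] : ssrc G (Arrow A, r') = ssrc G y \/
                 stgt G (Arrow A, r') = ssrc G y.
  - rewrite -xy xt /ssrc /stgt /=.
    by case/orP: zA => /eqP ->; case: (r'); [right|left|left|right].
  - by rewrite -(src_inj _ _ zs ys zy).
  (* If [A] were run into this point, it would have the same successor as [e], hence be the same
     step. *)
  have := nextP _ zs; rewrite zy => /src_inj nz.
  have zy' : next (steps g) (Edge e, r) = next (steps g) (Arrow A, r').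
    by rewrite yE; apply: nz; rewrite ?mem_next.
  by have /(congr1 fst) := can_inj (prev_next U) zy'.
case: y ys yE xy => -[//|A] r; rewrite -/(Arrow A) => ys yE xy _.
case: x xs yE xy => -[e|B] r'; rewrite -/(Edge _) -/(Arrow _) => xs yE xy.
  rewrite /marked /= inE (coef_step Uc xs) signr_eq0 /=.
  apply/existsP; exists A; rewrite (coef_step Uc ys) signr_eq0 /=.
  move: xy; rewrite (fwd _ _ xs) /stgt /ssrc /= => ->.
  by case: (r); rewrite eqxx ?orbT.
(* Consecutive arrows share an end, so they are one and the same step, whose source and target
   differ. *)
have AB : A = B.
  move: xy; rewrite /stgt /ssrc /=; have EI := @ends_inj n G.
  by case: (r); case: (r') => h;
    [have := EI (inl B) (inr A) h | have := EI (inr B) (inr A) h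
    |have := EI (inl B) (inl A) h | have := EI (inr B) (inl A) h] => -[].
have yx : (Arrow A, r) = (Arrow B, r').
  by apply: cell_inj => //=; rewrite AB.
by have := arrow_step_neq G B r'; rewrite -[in X in X != _]yx -xy eqxx.
Qed.

Theorem theorem3p22 (n : nat) (G : gauss n) (g : loop G)
    (g_proper : proper_loop g)
    (g_ER : edge_respecting (hclass g))
    (g_simple : simple_loop g) :
  torsion (hclass g) = (nearrow_circle (sigma g_simple))%:Z.
Proof.
have /andP[_ Uc] := g_simple; have cyc := cycle_turns g_ER g_simple.
set L := loop_edges (hclass g) in cyc.
(* Starting the turn at an arrow makes the step before it marked. *)
have [y ys yA] := hasP g_proper; have [i s' sE] := rot_to ys.
have fwd : all (fun y => ~~ y.2 || is_arrow y.1) (y :: s').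
  apply/allP => -[[e|A] r]; rewrite -sE mem_rot ?orbT //.
  move/(coef_step Uc) => /= eE; have := forallP g_ER e.
  by rewrite /Edge eE; case: r {eE}.
have pth : path (turns G L) (last y s') (y :: s').
  by rewrite -[path _ _ _](cycle_path y _ (y :: s')) -sE rot_cycle.
set x := last y s' in pth.
have xs : x \in y :: s' by apply: mem_last.
have mx : marked L x by case/andP: pth => /andP[_ /eqP ->].
have [c xc cL] : exists2 c, x.1 = Edge c & c \in L.
  by move: mx; rewrite /marked; case: (x.1) => // c cL; exists c.
(* After one turn the last marked edge is again [c], so the two potentials cancel. *)
have lastc d : last d (marked_edges L (y :: s')) = c.
  rewrite lastI -/x /marked_edges -cats1 pmap_cat /= xc /= filter_cat /= cL.
  by rewrite cats1 last_rcons.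
have := sum_weight_path cL (fun _ => xc) pth.
rewrite /= (allP fwd x xs) -/(all _ (y :: s')) fwd => /(_ isT).
rewrite -[last y s']/x.
have -> : last c (marked_edges L (y :: s')) = c := lastc c.
rewrite addrK -sE.
rewrite (perm_big (steps g)) ?perm_rot //=.
rewrite sum_weight_torsion // => ->; congr _%:Z.
have [k rotE] : exists k, marked_edges L (rot i (steps g)) =
    rot k (loop_edge_seq g).
  (* Rotating past [i] steps rotates past the marked edges among them. *)
  exists (size (marked_edges L (take i (steps g)))).
  have -> : loop_edge_seq g = marked_edges L (take i (steps g))
      ++ marked_edges L (drop i (steps g)).
    by rewrite /marked_edges -filter_cat -pmap_cat cat_take_drop.
  by rewrite rot_size_cat /rot /marked_edges pmap_cat filter_cat.
have U := loop_edge_seq_uniq g_simple.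
rewrite (nearrow_sigma _ c) -sum_next_ascents //.
(* Writing [c] as the last letter makes the word cyclic, hence insensitive to rotation. *)
have := lastc c; rewrite -sE rotE => {1}<-.
rewrite -sum_next_ascents ?rot_uniq // (perm_big (loop_edge_seq g)) /=.
  by apply: eq_bigr => e _; rewrite next_rot.
by rewrite perm_rot.
Qed.
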